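(* Let $X$ be a two dimensional real Banach space. Then $X$ has property (co).
   Context: $B_X$ denotes the closed unit ball of $X$, and $B(x,\delta)=\{y\in X:\|y-x\|<\delta\}$. A point $x\in B_X$ has property (co) if for every $n\in\mathbb N$, $n\ge2$, the following holds: whenever $x_1,\dots,x_n\in B_X$ and $\lambda_1,\dots,\lambda_n>0$, $\sum_{j=1}^n\lambda_j=1$, are such that $x=\sum_{j=1}^n\lambda_jx_j$, and $\varepsilon>0$, there is a $\delta>0$ such that, setting $B:=B(x,\delta)\cap B_X$, there are (norm-)continuous functions $\widehat v_j:B\to B_X$, $j\in\{1,\dots,n\}$, such that for every $u\in B$ one has $u=\sum_{j=1}^n\lambda_j\widehat v_j(u)$ and $\|\widehat v_j(u)-x_j\|<\varepsilon$ for every $j\in\{1,\dots,n\}$. The space $X$ has property (co) if every point $x\in B_X$ has property (co). *)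

(* Defs.v *)
From HB Require Import structures.
From mathcomp Require Import all_boot all_order all_algebra.
From mathcomp Require Import all_classical all_reals all_analysis.

Set Implicit Arguments.
Unset Strict Implicit.
Unset Printing Implicit Defensive.

Import Order.TTheory GRing.Theory Num.Theory.
Import numFieldNormedType.Exports.

Local Open Scope classical_set_scope.
Local Open Scope ring_scope.

Definition unit_ball (R : realType) (X : normedModType R) : set X :=
  [set x | `|x| <= 1].
Arguments unit_ball {R} X.

(* A map B -> B_X is encoded as a total map v j : X -> X of which only the
   values on B matter: it is continuous for the relative topology of B and
   sends B into B_X. *)
Definition point_property_co (R : realType) (X : normedModType R) (x : X) :
    Prop :=
  forall (n : nat) (y : 'I_n -> X) (lambda : 'I_n -> R) (eps : R),
    (2 <= n)%N ->
    (forall j, unit_ball X (y j)) ->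
    (forall j, 0 < lambda j) ->
    \sum_(j < n) lambda j = 1 ->
    x = \sum_(j < n) lambda j *: y j ->
    0 < eps ->
    exists2 delta : R, 0 < delta &
      let B := ball x delta `&` unit_ball X in
      exists v : 'I_n -> X -> X,
        [/\ forall j, {within B, continuous (v j)},
            forall j u, B u -> unit_ball X (v j u),
            forall u, B u -> u = \sum_(j < n) lambda j *: v j u &
            forall j u, B u -> `|v j u - y j| < eps].

Definition property_co (R : realType) (X : normedModType R) : Prop :=
  forall x : X, unit_ball X x -> point_property_co x.
Arguments property_co {R} X.

(* Main.v *)
From HB Require Import structures.
Require Import Defs.
From mathcomp Require Import all_boot all_order all_algebra.
From mathcomp Require Import all_classical all_reals all_analysis.
From mathcomp Require Import ring lra.

(** Why every two dimensional space has property (co).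

Let K be the unit ball and x = sum_j l_j y_j a convex combination in K.  The
map u |-> u - x is added to each y_j, after pulling y_j slightly towards x:
for a small s > 0, put v_j(u) = u + (1 - s)(y_j - x).  These translations
average to u, and they stay close to y_j; the only question is whether they
stay in K.  Since

    v_j(u) = (1 - s) y_j + s (x + (u - x) / s),

convexity reduces it to: if u in K is close enough to x, then the dilated
point x + (u - x) / s is still in K.  This says that near x the ball
behaves like a cone of apex x ([locally_conical]); [locally_conical_co] turns
it into property (co) at x.

In dimension two every point of K which is not extreme satisfies this.  For
|x| < 1 it is clear ([locally_conical_interior]).  If |x| = 1 and x is the
midpoint of a nondegenerate segment [x - w, x + w] of K, the segment lies in
an edge, and near x the ball is a half-plane: the coordinate along x in the
basis (x, w) plays the role of a supporting functional
([locally_conical_edge]).  If x is extreme, then all the y_j equal x and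
v_j(u) = u works ([extreme_co]). *)

Set Implicit Arguments.
Unset Strict Implicit.
Unset Printing Implicit Defensive.

Import Order.TTheory GRing.Theory Num.Theory.
Import numFieldNormedType.Exports.

Local Open Scope classical_set_scope.
Local Open Scope ring_scope.

(** A cone of apex x is invariant under all dilations of centre x.  Here this
invariance is asked of the ball near x: the enlargement of ratio 1/s must not
push out of the ball the points that are close to x, in terms of s. *)
Definition locally_conical (R : realType) (X : normedModType R) (x : X) :=
  forall s : R, 0 < s -> exists2 delta, 0 < delta &
    forall u : X, `|u - x| < delta -> `|u| <= 1 -> `|x + s^-1 *: (u - x)| <= 1.

Lemma norm_conv_le1 (R : realType) (X : normedModType R) (s : R) (y z : X) :
  0 <= s <= 1 -> `|y| <= 1 -> `|z| <= 1 -> `|(1 - s) *: y + s *: z| <= 1.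
Proof.
move=> /andP[s0 s1] y1 z1; apply: le_trans (ler_normD _ _) _.
by rewrite !normrZ (ger0_norm s0) ger0_norm ?subr_ge0//; nra.
Qed.

Lemma locally_conical_interior (R : realType) (X : normedModType R) (x : X) :
  `|x| < 1 -> locally_conical x.
Proof.
move=> x1 s s0; exists (s * (1 - `|x|)); first by rewrite mulr_gt0// subr_gt0.
move=> u ux _; apply: le_trans (ler_normD _ _) _.
rewrite normrZ gtr0_norm ?invr_gt0// -lerBrDl.
by rewrite ler_pdivrMl// ltW.
Qed.

(** The vectors a x + b w with |b| <= a form the cone spanned by x + w and
x - w, and the coefficients of such a vector on these generators sum to a. *)
Lemma norm_cone_le (R : realType) (X : normedModType R) (x w : X) (a b : R) :
  `|x + w| <= 1 -> `|x - w| <= 1 -> `|b| <= a -> `|a *: x + b *: w| <= a.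
Proof.
move=> xw1 xw2; rewrite ler_norml => /andP[ba1 ba2].
have -> : a *: x + b *: w
    = ((a + b) / 2) *: (x + w) + ((a - b) / 2) *: (x - w).
  rewrite scalerDr scalerBr addrACA -scalerDl -scalerBl.
  by congr (_ *: _ + _ *: _); field.
apply: le_trans (ler_normD _ _) _; rewrite !normrZ !ger0_norm; [nra|lra..].
Qed.

(** As x is on the sphere and inside a segment of the ball directed by w, the
line x + R w supports the ball.  Rather than invoking Hahn-Banach, the proof
adds to a x + b w the vector |b| x - b w of norm at most |b|, which leaves
(a + |b|) x. *)
Lemma le_norm_cone (R : realType) (X : normedModType R) (x w : X) (a b : R) :
  `|x| = 1 -> `|x + w| <= 1 -> `|x - w| <= 1 -> a <= `|a *: x + b *: w|.
Proof.
move=> x1 xw1 xw2; rewrite -(lerD2r `|b|).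
have cb : `| `|b| *: x + (- b) *: w| <= `|b|.
  by apply: norm_cone_le => //; rewrite normrN.
apply: le_trans (lerD (lexx _) cb); apply: le_trans (ler_normD _ _).
rewrite addrACA -!scalerDl subrr scale0r addr0 normrZ x1 mulr1.
exact: ler_norm.
Qed.

(** The matrix of the coordinates of x and w is square with independent rows,
so its rows span. *)
Lemma decomp_dim2 (R : realType) (X : normedModType R)
    (dimX : Vector.axiom 2 X) (x w : X) :
  (forall a b : R, a *: x + b *: w = 0 -> a = 0 /\ b = 0) ->
  forall u : X, exists a b : R, u = a *: x + b *: w.
Proof.
move=> xw_free u; have [f f_lin f_bij] := dimX.
pose fL := GRing.isLinear.Build _ _ _ _ f f_lin.
pose g : {linear X -> 'rV[R]_2} := HB.pack f fL.
pose M : 'M[R]_(1 + 1, 2) := col_mx (g x) (g w).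
have gM (c : 'rV[R]_(1 + 1)) :
    c *m M = g (lsubmx c 0 0 *: x + rsubmx c 0 0 *: w).
  rewrite -{1}(hsubmxK c) mul_row_col linearD !linearZ /=.
  by rewrite {1}[lsubmx c]mx11_scalar {1}[rsubmx c]mx11_scalar !mul_scalar_mx.
have M_free : row_free M.
  apply: inj_row_free => c; rewrite gM -[0 in RHS](linear0 g).
  move=> /(bij_inj f_bij)/xw_free[c1 c2].
  by rewrite -(hsubmxK c) [lsubmx c]mx11_scalar [rsubmx c]mx11_scalar c1 c2
    !raddf0 row_mx0.
have /submxP[c] : (g u <= M)%MS.
  by rewrite submx_full// row_full_unit -row_free_unit.
rewrite gM => /(bij_inj f_bij) ->.
by exists (lsubmx c 0 0), (rsubmx c 0 0).
Qed.

(** Write u - x = a x + b w.  Being in the ball forces a <= 0, and a and b are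
small with u - x.  The dilated point is (1 + a/s) x + (b/s) w: its
coordinate along x is still at most 1, and it is in the cone of
[norm_cone_le] as soon as |b| <= s + a. *)
Lemma locally_conical_edge (R : realType) (X : normedModType R)
    (dimX : Vector.axiom 2 X) (x w : X) :
  `|x| = 1 -> w != 0 -> `|x + w| <= 1 -> `|x - w| <= 1 -> locally_conical x.
Proof.
move=> x1 w0 xw1 xw2.
have abs_le (a b : R) : `|a| <= `|a *: x + b *: w|.
  rewrite ler_norml le_norm_cone// andbT lerNl -normrN opprD -!scaleNr.
  exact: le_norm_cone.
have w_gt0 : 0 < `|w| by rewrite normr_gt0.
have decomp : forall u : X, exists a b : R, u = a *: x + b *: w.
  apply: decomp_dim2 => // a b ab0.
  have a0 : a = 0.
    by apply/eqP; rewrite -normr_le0; have := abs_le a b; rewrite ab0 normr0.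
  split=> //; move: ab0; rewrite a0 scale0r add0r => /eqP.
  by rewrite scaler_eq0 (negbTE w0) orbF => /eqP.
(* With d = |u - x| one has - a <= d and |b| |w| <= 2 d, so that |b| <= s + a
   follows from 2 d / |w| + d <= s. *)
move=> s s0; exists (s * `|w| / (`|w| + 2)).
  by rewrite divr_gt0 ?mulr_gt0// addr_gt0.
move=> u; have [a [b uxE]] := decomp (u - x); rewrite uxE => ux u1.
have a_le0 : a <= 0.
  rewrite -(lerD2l 1) addr0; apply: le_trans u1.
  have -> : u = (1 + a) *: x + b *: w.
    by rewrite scalerDl scale1r -addrA -uxE addrC subrK.
  exact: le_norm_cone.
set d := `|a *: x + b *: w| in ux.
have ad : - a <= d by rewrite -(ler0_norm a_le0) abs_le.
have bd : `|b| * `|w| <= d + d.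
  rewrite -normrZ -[b *: w](addKr (a *: x)).
  apply: le_trans (ler_normD _ _) _.
  by rewrite addrC normrN normrZ x1 mulr1 lerD// abs_le.
have bsa : `|b| <= s + a.
  rewrite -(ler_pM2r w_gt0); apply: le_trans bd _.
  move: ux; rewrite ltr_pdivlMr; last by rewrite addr_gt0.
  by nra.
rewrite scalerDr addrA !scalerA -{1}(scale1r x) -scalerDl.
apply: le_trans (_ : 1 + s^-1 * a <= 1); last first.
  by rewrite gerDl mulr_ge0_le0// invr_ge0 ltW.
apply: norm_cone_le => //.
by rewrite normrM gtr0_norm ?invr_gt0// ler_pdivrMl// mulrDr mulr1 mulVKf ?gt_eqF.
Qed.

(** Replacing y_k with x in the combination x = sum_j l_j y_j gives exactly
x - l_k (y_k - x).  So the ball contains a segment from y_k that goes strictly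
beyond x whenever y_k differs from x. *)
Lemma norm_reflect_le1 (R : realType) (X : normedModType R) (n : nat)
    (y : 'I_n -> X) (l : 'I_n -> R) (k : 'I_n) :
  (forall j, `|y j| <= 1) -> (forall j, 0 < l j) -> \sum_(j < n) l j = 1 ->
  let x := \sum_(j < n) l j *: y j in
  `|x| <= 1 -> `|x - l k *: (y k - x)| <= 1.
Proof.
move=> y1 l0 l1 x x1.
have -> : x - l k *: (y k - x) = \sum_(j < n | j != k) l j *: y j + l k *: x.
  rewrite scalerBr opprB addrCA [RHS]addrC; congr (_ + _).
  by rewrite {1}/x (bigD1 k)//= addrAC subrr add0r.
have -> : 1 = \sum_(j < n | j != k) l j + l k :> R.
  by rewrite -l1 (bigD1 k)//= addrC.
have scale_le j (z : X) : `|z| <= 1 -> `|l j *: z| <= l j.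
  by move=> z1; rewrite normrZ gtr0_norm// ler_piMr// ltW.
apply: le_trans (ler_normD _ _) (lerD _ (scale_le _ _ x1)).
by apply: le_trans (ler_norm_sum _ _ _) (ler_sum _ _) => j _; exact: scale_le.
Qed.

Lemma locally_conical_co (R : realType) (X : normedModType R) (x : X) :
  unit_ball X x -> locally_conical x -> point_property_co x.
Proof.
move=> x1 xcone n y l eps _ y1 l0 l1 xE eps0.
(* |v_j(u) - y_j| is s times a distance between two points of the ball, hence
   at most 2 s; the factor 3 makes this less than eps. *)
pose s := Num.min 1 (eps / 3).
have s0 : 0 < s by rewrite lt_min ltr01 divr_gt0.
have s1 : s <= 1 by rewrite ge_min lexx.
have s3 : s <= eps / 3 by rewrite ge_min lexx orbT.
have [delta delta0 coneP] := xcone s s0.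
exists delta => // B.
have pB u : B u -> `|x + s^-1 *: (u - x)| <= 1.
  by rewrite /B -ball_normE /= => -[xu u1]; apply: coneP => //; rewrite distrC.
have vE j u : u + (1 - s) *: (y j - x)
    = (1 - s) *: y j + s *: (x + s^-1 *: (u - x)).
  rewrite (scalerDr s) scalerA mulfV ?gt_eqF// scale1r scalerBr addrC -addrA.
  congr (_ + _).
  by rewrite scalerBl scale1r opprB -addrA [- x + u]addrC.
exists (fun j u => u + (1 - s) *: (y j - x)); split.
- move=> j; apply: continuous_subspaceT => u.
  by apply: cvgD; [exact: cvg_id|exact: cvg_cst].
- move=> j u Bu; rewrite /unit_ball /= vE; apply: norm_conv_le1.
  + by rewrite (ltW s0).
  + exact: y1.
  + exact: pB.
- move=> u _; under eq_bigr do rewrite scalerDr scalerA mulrC -scalerA scalerBr.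
  rewrite big_split/= -scaler_suml l1 scale1r -scaler_sumr sumrB -xE.
  by rewrite -scaler_suml l1 scale1r subrr scaler0 addr0.
- move=> j u Bu; rewrite vE; have := pB u Bu; set p := x + _ => p1.
  have -> : (1 - s) *: y j + s *: p - y j = s *: (p - y j).
    by rewrite scalerBl scale1r addrAC [y j - _ - _]addrAC subrr add0r addrC
      -scalerBr.
  rewrite normrZ gtr0_norm//.
  have := le_trans (ler_normB _ _) (lerD p1 (y1 j)).
  by nra.
Qed.

(** By convexity on one side and [norm_reflect_le1] on the other, the ball
contains the segment of centre x and half-length l_j (y_j - x); at an extreme
point x it is trivial, that is y_j = x. *)
Lemma extreme_co (R : realType) (X : normedModType R) (x : X) :
  unit_ball X x -> (forall w, `|x + w| <= 1 -> `|x - w| <= 1 -> w = 0) ->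
  point_property_co x.
Proof.
move=> x1 xext n y l eps _ y1 l0 l1 xE eps0.
have yx j : y j = x.
  apply/eqP; rewrite -subr_eq0.
  suff /eqP : l j *: (y j - x) = 0 by rewrite scaler_eq0 gt_eqF.
  have lj1 : l j <= 1.
    by rewrite -l1 (bigD1 j)//= lerDl sumr_ge0// => i _; exact: ltW.
  apply: xext; last first.
    by rewrite xE; apply: norm_reflect_le1 => //; rewrite -xE.
  rewrite scalerBr addrCA -{1}(scale1r x) -scalerBl addrC.
  by apply: norm_conv_le1 => //; [rewrite ltW|exact: y1].
exists eps => // B; exists (fun=> id); split.
- by move=> j; apply: continuous_subspaceT => u; exact: cvg_id.
- by move=> j u [].
- by move=> u _; rewrite -scaler_suml l1 scale1r.
- by move=> j u; rewrite /B -ball_normE /= yx distrC => -[].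
Qed.

Theorem proposition3p7 (R : realType) (X : completeNormedModType R)
  (dimX : Vector.axiom 2 X) : property_co X.
Proof.
move=> x x1.
have [xlt1|xge1] := ltP `|x| 1.
  by apply: locally_conical_co => //; exact: locally_conical_interior.
have xE : `|x| = 1 by apply/eqP; rewrite eq_le xge1 andbT.
have [[w [w0 xw1 xw2]]|xext] :=
    pselect (exists w : X, [/\ w != 0, `|x + w| <= 1 & `|x - w| <= 1]).
  by apply: locally_conical_co => //; exact: (locally_conical_edge dimX xE w0).
apply: extreme_co => // w xw1 xw2; apply/eqP/negPn/negP => w0.
by apply: xext; exists w.
Qed.
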